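(* Let $g,h,j,k,s,t,u,v,w,x,y,z$ be commuting indeterminates. Then, in the polynomial ring $\mathbb{Z}[g,h,j,k,s,t,u,v,w,x,y,z]$, the following identity holds: $$ \det \begin{bmatrix} gj & g^2j^2x+h^2j^2z-hjv & g^2k^2x+h^2k^2z+hju \\ gk+hj & gjt-hkv & hku-gjs \\ hk & g^2j^2w+h^2j^2y+gkt & g^2k^2w+h^2k^2y-gks \end{bmatrix} = (g^2j^2s+g^2k^2t+h^2j^2u+h^2k^2v)\,(g^2j^2w+g^2k^2x+h^2j^2y+h^2k^2z). $$ *)

(* Defs.v *)
From mathcomp Require Import all_boot all_order all_algebra.
From mathcomp Require Export mpoly.

Set Implicit Arguments.
Unset Strict Implicit.
Unset Printing Implicit Defensive.

Import GRing.Theory.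
Local Open Scope ring_scope.

(* Missing entries are filled with zeros, so the row lists should have the
   announced shape. *)
Definition mx_of_rows (R : nmodType) (m n : nat) (rows : seq (seq R)) :
    'M[R]_(m, n) :=
  \matrix_(i < m, j < n) (nth [::] rows i)`_j.

(* Main.v *)
Require Import Defs.
From mathcomp Require Import all_boot all_order all_algebra.
From mathcomp Require Import ring.

Import GRing.Theory.
Local Open Scope ring_scope.

(** Put A = (j,k,0), B = (0,j,k), P = (g^2 x + h^2 z, 0, g^2 w + h^2 y). The columns are gA + hB,
    j^2 P - hvA + gtB and k^2 P + huA - gsB, so the determinant is (j^2(g^2 s + h^2 u) + k^2(g^2 t +
    h^2 v)) det(A,B,P), and det(A,B,P) is the second factor. The proof checks this by brute
    expansion with [det_mx_of_rows3], leaving a polynomial identity to [ring]. *)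

Lemma det_mx_of_rows3 (R : comNzRingType) (a b c d e f p q r : R) :
  \det (mx_of_rows 3 3 [:: [:: a; b; c]; [:: d; e; f]; [:: p; q; r]])
  = a * (e * r - f * q) - b * (d * r - f * p) + c * (d * q - e * p).
Proof.
rewrite (expand_det_row _ ord0) !big_ord_recl big_ord0 /cofactor.
(* The 2x2 minors are expanded in turn, leaving 1x1 determinants. *)
rewrite !(expand_det_row _ ord0) !big_ord_recl !big_ord0 /cofactor.
rewrite !det_mx11 !mxE /= /bump /=; ring.
Qed.

Theorem proposition1 :
  let g : {mpoly int[12]} := 'X_(inord 0) in
  let h : {mpoly int[12]} := 'X_(inord 1) in
  let j : {mpoly int[12]} := 'X_(inord 2) in
  let k : {mpoly int[12]} := 'X_(inord 3) in
  let s : {mpoly int[12]} := 'X_(inord 4) in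
  let t : {mpoly int[12]} := 'X_(inord 5) in
  let u : {mpoly int[12]} := 'X_(inord 6) in
  let v : {mpoly int[12]} := 'X_(inord 7) in
  let w : {mpoly int[12]} := 'X_(inord 8) in
  let x : {mpoly int[12]} := 'X_(inord 9) in
  let y : {mpoly int[12]} := 'X_(inord 10) in
  let z : {mpoly int[12]} := 'X_(inord 11) in
  \det (mx_of_rows 3 3
    [:: [:: g * j;
            g ^+ 2 * j ^+ 2 * x + h ^+ 2 * j ^+ 2 * z - h * j * v;
            g ^+ 2 * k ^+ 2 * x + h ^+ 2 * k ^+ 2 * z + h * j * u];
        [:: g * k + h * j;
            g * j * t - h * k * v;
            h * k * u - g * j * s];
        [:: h * k;
            g ^+ 2 * j ^+ 2 * w + h ^+ 2 * j ^+ 2 * y + g * k * t;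
            g ^+ 2 * k ^+ 2 * w + h ^+ 2 * k ^+ 2 * y - g * k * s]])
  = (g ^+ 2 * j ^+ 2 * s + g ^+ 2 * k ^+ 2 * t
     + h ^+ 2 * j ^+ 2 * u + h ^+ 2 * k ^+ 2 * v)
    * (g ^+ 2 * j ^+ 2 * w + g ^+ 2 * k ^+ 2 * x
       + h ^+ 2 * j ^+ 2 * y + h ^+ 2 * k ^+ 2 * z).
Proof.
move=> g h j k s t u v w x y z; rewrite det_mx_of_rows3.
(* Only commutativity matters: the indeterminates become arbitrary ring elements, atoms for
   [ring]. *)
clearbody g h j k s t u v w x y z; ring.
Qed.
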